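(* Let $q$ be an odd prime power, $m\geq 2$ and $n=\frac{q^m+1}{2}$. Let $\delta$ be an integer with $2\leq\delta\leq\frac{q^{m/2}+3}{2}$ if $m\geq 4$ is even, and $2\leq\delta\leq\frac{q^{(m+1)/2}-q+2}{2}$ if $m\geq 3$ is odd. Then the negacyclic BCH code $\mathcal{C}_{(q,n,\delta,0)}$ has parameters $$\left[n,\ n-2m\left\lceil\frac{(2\delta-3)(q-1)}{2q}\right\rceil,\ d\right]$$ and generator polynomial $$g(x)=\prod_{\substack{0\leq i\leq\delta-2\\ i\not\equiv\frac{q-1}{2}\pmod q}}\mathbb{M}_{\beta^{1+2i}}(x),$$ where $d\geq 2\delta+1$ if $\delta\equiv\frac{q+1}{2}\pmod q$, and $d\geq 2\delta-1$ otherwise.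
   Context: Let $q$ be an odd prime power and $n$ a positive integer with $\gcd(n,q)=1$. Let $\ell$ be the order of $q$ modulo $2n$, $\alpha$ a primitive element of $\mathrm{GF}(q^\ell)$ and $\beta=\alpha^{(q^\ell-1)/(2n)}$, a primitive $2n$-th root of unity. $\mathbb{M}_{\beta^{j}}(x)$ is the minimal polynomial of $\beta^{j}$ over $\mathrm{GF}(q)$. For $2\leq\delta\leq n$, $\mathcal{C}_{(q,n,\delta,0)}$ is the negacyclic code of length $n$ over $\mathrm{GF}(q)$ (ideal of $\mathrm{GF}(q)[x]/(x^n+1)$) generated by $\mathrm{lcm}\big(\mathbb{M}_{\beta^{1}}(x),\mathbb{M}_{\beta^{3}}(x),\ldots,\mathbb{M}_{\beta^{1+2(\delta-2)}}(x)\big)$. Parameters $[n,k,d]$ are length, dimension, minimum Hamming distance. *)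

(* Defs.v *)
From HB Require Import structures.
From mathcomp Require Import all_boot all_order all_algebra all_field.
Set Implicit Arguments. Unset Strict Implicit. Unset Printing Implicit Defensive.
Import Order.TTheory GRing.Theory.
Local Open Scope ring_scope.

Definition is_mult_order (q k l : nat) : Prop :=
  [/\ (0 < l)%N, (q ^ l %% k = 1 %% k)%N &
      forall j, (0 < j < l)%N -> (q ^ j %% k != 1 %% k)%N].

Definition ceil_div (a b : nat) : nat := ((a + b).-1 %/ b)%N.

Definition is_minpoly (F : fieldType) (L : fieldExtType F) (x : L) (p : {poly F}) : Prop :=
  [/\ p \is monic, root (map_poly (in_alg L) p) x &
      forall r : {poly F}, root (map_poly (in_alg L) r) x -> p %| r].

(* Least common multiple of polynomials (defined up to a nonzero constant,
   which does not affect the ideal it generates). *)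
Definition lcmp (F : fieldType) (p r : {poly F}) : {poly F} := (p * r) %/ gcdp p r.

(* The ideal generated by g in F[x]/(x^n + 1), viewed as a subspace of F^n
   (a polynomial c_0 + ... + c_{n-1} x^{n-1} is the row vector (c_0,...,c_{n-1})).
   The ideal {(a * g) mod (x^n+1) | a in F[x]} is spanned by the (x^i g) mod (x^n+1), i < n. *)
Definition negacyclic_code (F : fieldType) (n : nat) (g : {poly F}) : {vspace 'rV[F]_n} :=
  <<[seq (poly_rV ((('X ^+ i * g) %% ('X ^+ n + 1))) : 'rV[F]_n) | i <- iota 0 n]>>%VS.

Definition wt (F : finFieldType) (n : nat) (c : 'rV[F]_n) : nat := #|[set i | c 0 i != 0]|.

Definition min_dist (F : finFieldType) (n : nat) (C : {vspace 'rV[F]_n}) : nat :=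
  \big[minn/n]_(c : 'rV[F]_n | (c \in C) && (c != 0)) wt c.

Definition is_generator_poly (F : fieldType) (n : nat) (C : {vspace 'rV[F]_n}) (g : {poly F}) : Prop :=
  [/\ g \is monic, g %| 'X ^+ n + 1 & C = negacyclic_code n g].

(* C_(q,n,delta,0) : generated by lcm(M_{beta^1}, M_{beta^3}, ..., M_{beta^{1+2(delta-2)}}),
   where M j is the minimal polynomial of beta^j over F. *)
Definition nbch_code (F : fieldType) (n delta : nat) (M : nat -> {poly F}) : {vspace 'rV[F]_n} :=
  negacyclic_code n (\big[@lcmp F/1]_(0 <= i < delta.-1) M (1 + 2 * i)%N).

(* Main.v *)
(* Since 2n = q^m + 1, q^m acts on exponents as -1, so every q-cyclotomic coset
   modulo 2n is symmetric. For odd j <= 2 delta - 3 prime to q these cosets are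
   pairwise disjoint of full size 2m: a coincidence can be multiplied by a
   power of q so that it reads j q^t = +-j' mod 2n with t <= m/2, where both
   sides are too small to differ by a nonzero multiple of 2n. Exponents divisible
   by q contribute no new minimal polynomial. By symmetry beta^j is a root of
   the generator for all odd j from -(2 delta - 3) to 2 delta - 3, and also for
   j = +-(2 delta - 1) when q divides 2 delta - 1; the BCH bound concludes. *)
Require Import Defs.
From HB Require Import structures.
From mathcomp Require Import all_boot all_order all_algebra all_field.
From mathcomp Require Import zify ring.
Import Order.TTheory GRing.Theory.
Local Open Scope ring_scope.

(** * Cyclotomic cosets modulo q^m + 1 *)

Lemma dvdn_lt_eq0 (d a : nat) : (a < d)%N -> (d %| a)%N -> a = 0%N.
Proof. by move=> lt_ad; rewrite /dvdn modn_small // => /eqP. Qed.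

(** Modulo q^m + 1 the factor q^m is -1, so the hypothesis reads -a = j. *)
Lemma mod_expn_pred (q m : nat) (a j : nat) :
  ((a * q ^ m) %% (q ^ m + 1) = j %% (q ^ m + 1) -> q ^ m + 1 %| a + j)%N.
Proof.
move=> e; have : (a * q ^ m + a == j + a %[mod q ^ m + 1])%N by rewrite eqn_modDr e.
rewrite -{2}[a]muln1 -mulnDr modnMl eq_sym addnC /dvdn.
by move/eqP->.
Qed.

Section CosetLeaders.

Variables q m B : nat.
Hypothesis q_gt1 : (1 < q)%N.
Hypothesis B_small : forall t, (t <= m %/ 2)%N -> (B * q ^ t + B < q ^ m + 1)%N.

Let N := (q ^ m + 1)%N.

(** The cases split e at m/2, m and m + m/2. In each, multiplying by a power of q and using q^m = -1
    leaves an exponent at most m/2. In the two middle ranges the sign is - and [N] would divide a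
    positive number below [N]. In the outer ones the sign is +, so the integers themselves agree and
    q divides j or j' unless e = 0. *)
Lemma coset_shift_trivial j j' e :
    (0 < j <= B)%N -> (0 < j' <= B)%N -> ~~ (q %| j)%N -> ~~ (q %| j')%N ->
    (e < 2 * m)%N -> (j = j' * q ^ e %[mod N])%N -> e = 0%N /\ j = j'.
Proof.
move=> /andP[j0 jB] /andP[j'0 j'B] qj qj' em E.
have small i i' t : (i <= B)%N -> (i' <= B)%N -> (t <= m %/ 2)%N -> (i * q ^ t + i' < N)%N.
  move=> iB i'B /B_small; apply: leq_ltn_trans.
  by rewrite leq_add // leq_mul2r iB orbT.
have shift f : (j * q ^ f = j' * q ^ (e + f) %[mod N])%N.
  by rewrite expnD mulnA -modnMml E modnMml.
have contra a b t : (0 < b)%N -> (a <= B)%N -> (b <= B)%N -> (t <= m %/ 2)%N ->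
    (N %| a * q ^ t + b)%N -> False.
  move=> b0 aB bB tm /(dvdn_lt_eq0 _ _ (small _ _ _ aB bB tm)); lia.
have [e_le|e_gt] := leqP e (m %/ 2).
  have jE : j = (j' * q ^ e)%N.
    have := small _ _ _ j'B jB e_le => sm.
    by move: E; rewrite !modn_small //; lia.
  case: e {em E shift e_le} jE => [|e] jE; first by rewrite jE muln1.
  by case/negP: qj; rewrite jE expnS mulnCA dvdn_mulr.
have [e_le|e_gt'] := leqP e m.
  case: (contra j j' (m - e)%N) => //; first lia.
  by rewrite addnC; apply: mod_expn_pred; rewrite shift subnKC.
have [e_le|e_gt''] := leqP (e - m) (m %/ 2).
  case: (contra j' j (e - m)%N) => //.
  apply: mod_expn_pred.
  by rewrite -mulnA -expnD subnK // ltnW.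
have fE : (e + (2 * m - e) = m + m)%N by lia.
have f_le : (2 * m - e <= m %/ 2)%N by lia.
have j'E : (j * q ^ (2 * m - e) = j')%N.
  have lt1 := small _ _ _ jB j'B f_le.
  have : (j * q ^ (2 * m - e) = j' %[mod N])%N.
    rewrite shift fE expnD.
    apply/eqP; rewrite -(eqn_modDr (j' * q ^ m)) /N.
    have -> : (j' * (q ^ m * q ^ m) + j' * q ^ m = j' * q ^ m * (q ^ m + 1))%N by ring.
    have -> : (j' + j' * q ^ m = j' * (q ^ m + 1))%N by ring.
    by rewrite !modnMl.
  by rewrite !modn_small //; lia.
case/negP: qj'; rewrite -j'E.
have -> : (2 * m - e = (2 * m - e).-1.+1)%N by lia.
by rewrite expnS mulnCA dvdn_mulr.
Qed.

Lemma coset_leaders_distinct j j' k k' :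
    (0 < j <= B)%N -> (0 < j' <= B)%N -> ~~ (q %| j)%N -> ~~ (q %| j')%N ->
    (k < 2 * m)%N -> (k' < 2 * m)%N ->
    (j * q ^ k = j' * q ^ k' %[mod N])%N -> j = j' /\ k = k'.
Proof.
wlog le_kk : j j' k k' / (k <= k')%N.
  move=> IH; have [le_kk|/ltnW le_kk] := leqP k k'; first exact: IH.
  move=> hj hj' qj qj' hk hk' E.
  by have [-> ->] := IH j' j k' k le_kk hj' hj qj' qj hk' hk (esym E).
move=> hj hj' qj qj' hk hk' E.
(* If k > 0 then m > 0, so q is prime to q^m + 1 and q^k can be cancelled. *)
have cop : coprime N (q ^ k).
  have [->|k0] := posnP k; first by rewrite coprimen1.
  rewrite coprimeXr // /N coprime_sym; case: m hk => [|m'] // _.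
  by rewrite expnS mulnC /coprime gcdnMDl gcdn1.
have E' : (j = j' * q ^ (k' - k) %[mod N])%N.
  have := E; rewrite -{1}(subnK le_kk) expnD mulnA => /eqP.
  have G a b : (a <= b)%N -> (a * q ^ k == b * q ^ k %[mod N])%N -> a = b %[mod N].
    move=> ab; rewrite eq_sym eqn_mod_dvd ?leq_mul2r ?ab ?orbT // -mulnBl Gauss_dvdl //.
    by rewrite -eqn_mod_dvd // eq_sym => /eqP.
  have [/G G' /G' //|/ltnW/G G'] := leqP j (j' * q ^ (k' - k)).
  by rewrite eq_sym => /G'.
have [e0 ->] := coset_shift_trivial _ _ _ hj hj' qj qj' (leq_ltn_trans (leq_subr _ _) hk') E'.
by split=> //; apply/eqP; rewrite eqn_leq le_kk -subn_eq0 e0.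
Qed.

End CosetLeaders.

(* The largest exponent 2 delta - 3 is lowered by one when q divides it: for m
   even it can be q^(m/2), and then the bound holds only without this term. *)
Lemma designed_bound_small (q m delta t : nat) : (3 <= q)%N ->
    (~~ odd m /\ (4 <= m)%N /\ (delta <= (q ^ (m %/ 2) + 3) %/ 2)%N)
    \/ (odd m /\ (3 <= m)%N /\ (delta <= (q ^ ((m + 1) %/ 2) - q + 2) %/ 2)%N) ->
  (2 <= delta)%N ->
  (t <= m %/ 2)%N ->
  forall B, B = (2 * delta - 3 - (q %| 2 * delta - 3))%N -> (B * q ^ t + B < q ^ m + 1)%N.
Proof.
move=> q3 hd d2 tm B BE.
have qt : (q ^ t <= q ^ (m %/ 2))%N by rewrite leq_exp2l //; lia.
have BqE : (B * q ^ t <= B * q ^ (m %/ 2))%N by rewrite leq_mul2l qt orbT.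
apply: leq_ltn_trans (_ : (B * q ^ (m %/ 2) + B < _)%N); first by rewrite leq_add2r.
case: hd => [[me [m4 dle]]|[mo [m3 dle]]].
  have mE : m = (m %/ 2 + m %/ 2)%N by lia.
  rewrite {2}mE expnD.
  move: (m %/ 2)%N m4 mE dle => r m4 mE dle {tm qt BqE}.
  have qr : (q %| q ^ r)%N by rewrite dvdn_exp //; lia.
  (* With Q = q^(m/2), this gives B(Q + 1) <= Q^2 - 1. *)
  have : (B <= q ^ r - 1)%N.
    rewrite BE; case: (eqVneq (2 * delta - 3)%N (q ^ r)%N) => [->|]; first by rewrite qr.
    by lia.
  by move: (q ^ r)%N => Q; nia.
have mE : m = (m %/ 2 + (m %/ 2).+1)%N by lia.
have -> : (q ^ m = q ^ (m %/ 2) * (q * q ^ (m %/ 2)))%N by rewrite {1}mE expnD expnS.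
have mE1 : ((m + 1) %/ 2 = (m %/ 2).+1)%N by lia.
move: dle; rewrite mE1 expnS.
have : (q <= q ^ (m %/ 2))%N by rewrite -{1}[q]expn1 leq_exp2l; lia.
move: (q ^ (m %/ 2))%N => Q.
(* With Q = q^((m-1)/2), 2 delta - 3 <= qQ - q - 1, hence B(Q + 1) <= qQ^2 - Q - q - 1. *)
have : (B <= 2 * delta - 3)%N by rewrite BE leq_subr.
move: B {BE BqE} => B; nia.
Qed.
 
(** The minimum in [min_dist] starts from n, so a lower bound on it must not exceed n. This checks
    the larger of the two claimed bounds. *)
Lemma designed_distance_le (q m delta : nat) : (3 <= q)%N ->
    (~~ odd m /\ (4 <= m)%N /\ (delta <= (q ^ (m %/ 2) + 3) %/ 2)%N)
    \/ (odd m /\ (3 <= m)%N /\ (delta <= (q ^ ((m + 1) %/ 2) - q + 2) %/ 2)%N) ->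
  (2 * delta + 1 <= (q ^ m + 1) %/ 2)%N.
Proof.
move=> q3 [[me [m4 dle]]|[mo [m3 dle]]].
  have -> : (q ^ m = q ^ (m %/ 2) * q ^ (m %/ 2))%N by rewrite -expnD; congr expn; lia.
  have : (q ^ 2 <= q ^ (m %/ 2))%N by rewrite leq_exp2l; lia.
  by move: (q ^ (m %/ 2))%N dle => Q; nia.
have -> : (q ^ m = q ^ (m %/ 2) * (q * q ^ (m %/ 2)))%N by rewrite -expnS -expnD; congr expn; lia.
have mE1 : ((m + 1) %/ 2 = (m %/ 2).+1)%N by lia.
move: dle; rewrite mE1 expnS.
have : (q <= q ^ (m %/ 2))%N by rewrite -{1}[q]expn1 leq_exp2l; lia.
move: (q ^ (m %/ 2))%N => Q; nia.
Qed.

Lemma dvdn_odd_index (q i : nat) : odd q ->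
  (q %| 1 + 2 * i)%N = (i %% q == (q - 1) %/ 2)%N.
Proof.
move=> qo; have q0 : (0 < q)%N by case: q qo.
have iq := ltn_pmod i q0.
rewrite {1}(divn_eq i q) mulnDr addnCA mulnA dvdn_addr ?dvdn_mull //.
(* For a residue r < q, 1 + 2r is positive and below 2q, so it can only be the multiple q itself. *)
apply/idP/eqP => [/dvdnP[[|[|c]] E]|->]; try nia.
by rewrite (_ : 1 + _ = q)%N //; lia.
Qed.

Lemma count_coset_leaders (q delta : nat) : odd q -> (1 < q)%N -> (2 <= delta)%N ->
  (count (fun i => i %% q != (q - 1) %/ 2) (index_iota 0 delta.-1)
   = ceil_div ((2 * delta - 3) * (q - 1)) (2 * q))%N.
Proof.
move=> qo q1 d2; set P := (fun i => _).
(* The quotient counts the excluded i < e: passing from e to e + 1, it grows exactly when q divides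
   2e + 1. *)
have cnt e : (count P (index_iota 0 e) + (e + (q - 1) %/ 2) %/ q = e)%N.
  elim: e => [|e IH]; first by rewrite /= add0n divn_small //; lia.
  have -> : index_iota 0 e.+1 = rcons (index_iota 0 e) e
    by rewrite /index_iota !subn0 -addn1 iotaD cats1.
  rewrite -cats1 count_cat /= addn0 addSn divnS; last lia.
  have -> : (q %| (e + (q - 1) %/ 2).+1)%N = ~~ P e.
    rewrite negbK -dvdn_odd_index // -(@Gauss_dvdr q 2); last by rewrite coprimen2.
    have -> : (2 * (e + (q - 1) %/ 2).+1 = (1 + 2 * e) + q)%N by lia.
    by rewrite dvdn_addl.
  by case: (P e); rewrite /=; lia.
have := cnt delta.-1; rewrite /ceil_div; move: (count _ _) => c.
have := divn_eq (delta.-1 + (q - 1) %/ 2) q.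
have : ((delta.-1 + (q - 1) %/ 2) %% q < q)%N by rewrite ltn_pmod //; lia.
move: (_ %% q)%N ((_ + _) %/ q)%N => b a bq abE cE.
(* Euclidean division by 2q of the numerator in [ceil_div]: the quotient is c, and b < q puts the
   remainder between 1 and 2q - 1. *)
have -> : (((2 * delta - 3) * (q - 1) + 2 * q).-1
           = c * (2 * q) + (2 * q - 2 * b - 1))%N.
  have [h hE] : exists h, (q = 2 * h + 1)%N by exists (q %/ 2)%N; lia.
  have h2 : ((q - 1) %/ 2 = h)%N by lia.
  have q1E : (q - 1 = 2 * h)%N by lia.
  move: abE cE; rewrite h2 q1E; case: (delta) d2 => [|[|e]] // _ /= abE cE.
  have -> : (2 * e.+2 - 3 = 2 * e + 1)%N by lia.
  have := congr1 (muln h) cE; subst q; rewrite mulnDr; nia.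
rewrite divnMDl; last lia.
by rewrite divn_small ?addn0 //; lia.
Qed.

(** * Least common multiples of polynomials *)

Lemma dvdp_lcmp (F : fieldType) (p r h : {poly F}) : p != 0 -> r != 0 ->
  (lcmp p r %| h) = (p %| h) && (r %| h).
Proof.
move=> p0 r0; set g := gcdp p r.
have g0 : g != 0 by rewrite gcdp_eq0 (negPf p0).
have pE : p = (p %/ g) * g by rewrite divpK ?dvdp_gcdl.
have rE : r = (r %/ g) * g by rewrite divpK ?dvdp_gcdr.
have cop : coprimep (p %/ g) (r %/ g) by rewrite coprimep_div_gcd ?p0.
(* The cofactors of the gcd are coprime, so Gauss's lemma applies to them. *)
have -> : lcmp p r = (p %/ g) * (r %/ g) * g.
  by rewrite /lcmp -/g [X in p * X]rE mulrA mulpK // [X in X * _]pE mulrAC.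
apply/idP/andP=> [dv|[]].
  split; apply: dvdp_trans dv.
    by rewrite [X in X %| _]pE dvdp_mul2r // dvdp_mulr.
  by rewrite [X in X %| _]rE dvdp_mul2r // dvdp_mull.
move=> ph /dvdpP[u hE]; move: ph; rewrite hE.
rewrite [X in X %| _]pE [X in u * X]rE mulrA dvdp_mul2r // => pu.
by rewrite dvdp_mul2r // dvdp_mul // -(Gauss_dvdpl _ cop).
Qed.

Lemma lcmp_neq0 (F : fieldType) (p r : {poly F}) : p != 0 -> r != 0 -> lcmp p r != 0.
Proof.
move=> p0 r0; have : p * r != 0 by rewrite mulf_neq0.
apply: contraNneq => l0; rewrite -dvd0p -l0 dvdp_lcmp //.
by rewrite dvdp_mulr // dvdp_mull.
Qed.

Lemma dvdp_biglcmp (F : fieldType) (I : Type) (s : seq I) (M : I -> {poly F}) h :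
  (forall i, M i != 0) ->
  (\big[@lcmp F/1]_(i <- s) M i %| h) = all (fun i => M i %| h) s.
Proof.
move=> M0; elim: s h => [|i s IH] h; first by rewrite big_nil dvd1p.
rewrite big_cons dvdp_lcmp ?IH //.
elim: s {IH h} => [|j s IH]; first by rewrite big_nil oner_neq0.
by rewrite big_cons lcmp_neq0.
Qed.

(** * Membership in negacyclic codes and their dimension *)

Section NegacyclicCode.

Variables (F : fieldType) (n : nat).
Hypothesis n_gt0 : (0 < n)%N.

Lemma size_XnD1 : size ('X ^+ n + 1 : {poly F}) = n.+1.
Proof. by rewrite size_polyDl ?size_polyXn // size_poly1. Qed.

(** An lcm is determined only up to a nonzero constant, so the code must not depend on the associate
    chosen as generator. *)
Lemma negacyclic_code_eqp (g h : {poly F}) : g %= h ->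
  negacyclic_code n g = negacyclic_code n h.
Proof.
suff sub (p r : {poly F}) : p %= r -> (negacyclic_code n p <= negacyclic_code n r)%VS.
  by move=> gh; apply: subv_anti; rewrite !sub // eqp_sym.
move=> /eqpf_eq[c c0 ->]; apply/span_subvP=> _ /mapP[i i_n ->].
rewrite -scalerAr modpZl linearZ memvZ //.
by apply: memv_span; apply/mapP; exists i.
Qed.

(** Reduction modulo X^n + 1 preserves divisibility by g. Conversely, a nonzero multiple a * g of
    degree below n combines the X^i g with i < [size a], which reduction leaves unchanged. *)
Lemma mem_negacyclic_code (g : {poly F}) (c : 'rV[F]_n) : g %| 'X ^+ n + 1 ->
  (c \in negacyclic_code n g) = (g %| rVpoly c).
Proof.
move=> gX; have sX := size_XnD1; have X0 : ('X ^+ n + 1 : {poly F}) != 0.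
  by rewrite -size_poly_eq0 sX.
apply/idP/idP => [/coord_span ->|].
  rewrite linear_sum; apply: (big_ind (fun p => g %| p)) => [|p r|i _].
  - exact: dvdp0.
  - exact: dvdp_add.
  rewrite linearZ /= -mul_polyC dvdp_mull // -tnth_nth tnth_map.
  rewrite poly_rV_K; last by rewrite -ltnS -sX ltn_modp.
  by rewrite -(dvdp_mod _ gX) dvdp_mull.
case/dvdpP=> a cE.
have [a0|a0] := eqVneq a 0.
  by rewrite -[c]rVpolyK cE a0 mul0r linear0 mem0v.
have g0 : g != 0 by apply: contraTneq gX => ->; rewrite dvd0p.
have sag : (size (a * g)%R <= n)%N by rewrite -cE size_poly.
rewrite -[c]rVpolyK cE -[a]coefK poly_def mulr_suml linear_sum memv_suml // => i _.
have sXg : (size ('X ^+ i * g)%R <= n)%N.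
  apply: leq_trans sag; rewrite (size_mul a0) // size_monicM ?monicXn // size_polyXn.
  by rewrite -!subn1 leq_sub2r // leq_add2r.
rewrite /= -scalerAl linearZ memvZ //; apply: memv_span; apply/mapP; exists (nat_of_ord i).
  rewrite mem_iota /= add0n; apply: leq_trans sXg.
  rewrite size_monicM ?monicXn // size_polyXn.
  by rewrite addSn /= -addn1 leq_add2l lt0n size_poly_eq0.
by rewrite modp_small // sX ltnS.
Qed.

(** Multiplication by g maps the polynomials of degree below n - deg g isomorphically onto the
    code. *)
Lemma dim_negacyclic_code (g : {poly F}) : g %| 'X ^+ n + 1 ->
  \dim (negacyclic_code n g) = (n - (size g).-1)%N.
Proof.
move=> gX; have X0 : ('X ^+ n + 1 : {poly F}) != 0 by rewrite -size_poly_eq0 size_XnD1.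
have g0 : g != 0 by apply: contraTneq gX => ->; rewrite dvd0p.
have sg : (0 < size g)%N by rewrite lt0n size_poly_eq0.
have sgn : (size g <= n.+1)%N by rewrite -size_XnD1 dvdp_leq.
set d := (n - (size g).-1)%N.
pose mulg (a : 'rV[F]_d) : 'rV[F]_n := poly_rV (rVpoly a * g).
have mulgP (a : 'rV[F]_d) : rVpoly (mulg a) = rVpoly a * g.
  rewrite poly_rV_K //; apply: leq_trans (size_polyMleq _ _) _.
  by have := size_poly d (fun k => oapp (a 0) 0 (insub k)); rewrite -/(rVpoly a) /d; lia.
have mulg_lin : linear mulg.
  by move=> k u v; rewrite /mulg linearP mulrDl -scalerAl linearP.
pose L : {linear 'rV[F]_d -> 'rV[F]_n} := HB.pack mulg (GRing.isLinear.Build _ _ _ _ mulg mulg_lin).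
have -> : negacyclic_code n g = limg (linfun L).
  apply/vspaceP=> c; rewrite mem_negacyclic_code //; apply/idP/memv_imgP.
    case/dvdpP=> a cE; exists (poly_rV a); first exact: memvf.
    rewrite lfunE /=; apply: (can_inj rVpolyK); rewrite mulgP poly_rV_K //.
    have [->|a0] := eqVneq a 0; first by rewrite size_poly0.
    have : (size (a * g)%R <= n)%N by rewrite -cE size_poly.
    rewrite size_mul // /d; move: sg; move: (size a) (size g) => sa sg; lia.
  by case=> a _ ->; rewrite lfunE /= mulgP dvdp_mull.
rewrite limg_dim_eq; first by rewrite dimvf /dim /= mul1n.
apply/eqP; rewrite -subv0; apply/subvP=> a; rewrite memv_cap memv_ker lfunE memv0 /=.
case/andP=> _ /eqP a0; apply/eqP/(can_inj rVpolyK)/(mulIf g0).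
by rewrite -mulgP a0 !linear0 mul0r.
Qed.

End NegacyclicCode.

(** * Minimum distance and the BCH bound *)

Lemma geq_min_dist (F : finFieldType) (n D : nat) (C : {vspace 'rV[F]_n}) : (D <= n)%N ->
  (forall c, c \in C -> c != 0 -> (D <= wt c)%N) -> (D <= min_dist C)%N.
Proof.
move=> Dn DC; rewrite /min_dist; apply: (big_ind (leq D)) => // [a b Da Db|c /andP[]].
  by rewrite leq_min Da Db.
exact: DC.
Qed.

(* If wt c <= D, a polynomial P of size <= D vanishes at the points beta^(2s)
   with s in the support of c, except one; summing the D root conditions with
   the coefficients of P as weights isolates one nonzero coordinate of c. *)
Lemma BCH_bound (F : finFieldType) (L : fieldExtType F) (n a D : nat) (beta : L)
    (c : 'rV[F]_n) : (2 * n)%N.-primitive_root beta -> c != 0 ->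
  (forall i, (i < D)%N -> root (map_poly (in_alg L) (rVpoly c)) (beta ^+ (a + 2 * i))) ->
  (D < wt c)%N.
Proof.
move=> prim c0 rt; rewrite ltnNge; apply/negP=> wD.
have [s0 s0c] : exists s, c 0 s != 0.
  by have /rV0Pn := c0.
pose supp := enum [set i | c 0 i != 0].
pose rs := [seq beta ^+ (2 * (s : 'I_n)) | s <- rem s0 supp].
pose P : {poly L} := \prod_(z <- rs) ('X - z%:P).
have s0_supp : s0 \in supp by rewrite mem_enum inE.
have mem_rs s : (s \in rem s0 supp) = (s != s0) && (c 0 s != 0).
  by rewrite mem_rem_uniq ?enum_uniq // inE mem_enum inE.
have sP : (size P <= D)%N.
  apply: leq_trans wD; rewrite size_prod_XsubC size_map size_rem //.
  rewrite prednK; first by rewrite /wt cardE.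
  by rewrite lt0n; apply: contraTneq s0_supp => /size0nil ->.
have : \sum_(s < n) (c 0 s)%:A * beta ^+ (a * s) * P.[beta ^+ (2 * s)] = 0.
  transitivity (\sum_(i < D) P`_i * (map_poly (in_alg L) (rVpoly c)).[beta ^+ (a + 2 * i)]).
    transitivity (\sum_(s < n) \sum_(i < D) P`_i * ((c 0 s)%:A * beta ^+ (a + 2 * i) ^+ s)).
      apply: eq_bigr => s _; rewrite (horner_coef_wide _ sP) mulr_sumr.
      apply: eq_bigr => i _; rewrite -!exprM mulrCA -!mulrA -exprD; congr (_ * (_ * beta ^+ _)).
      by rewrite mulnDl mulnAC.
    rewrite exchange_big; apply: eq_bigr => i _; rewrite -mulr_sumr; congr (_ * _).
    rewrite (@horner_coef_wide _ n); last by rewrite size_map_poly size_poly.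
    by apply: eq_bigr => s _; rewrite coef_map coef_rVpoly_ord.
  by apply: big1 => i _; rewrite (rootP (rt _ (ltn_ord i))) mulr0.
rewrite (bigD1 s0) //= big1 ?addr0 => [|s s_s0]; last first.
  have [->|sc] := eqVneq (c 0 s) 0; first by rewrite scale0r !mul0r.
  apply/eqP; rewrite mulf_eq0 orbC -[_ == 0]/(root _ _) root_prod_XsubC.
  by apply/orP; left; apply/map_f; rewrite mem_rs s_s0.
have beta0 : beta != 0.
  apply: contraTneq prim => ->; apply/negP => pr0.
  have := prim_expr_order pr0; rewrite expr0n.
  by have := prim_order_gt0 pr0; case: (2 * n)%N => // k _ /eqP; rewrite eq_sym oner_eq0.
apply/eqP; rewrite !mulf_neq0 ?expf_neq0 ?scaler_eq0 ?oner_eq0 ?orbF //.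
(* As beta has order 2n, the points beta^(2s) with s < n are distinct, so P does not vanish at the
   one left out. *)
rewrite -[_ == 0]/(root _ _) root_prod_XsubC.
apply/mapP=> -[s]; rewrite mem_rs => /andP[s_s0 _] /eqP.
rewrite (eq_prim_root_expr prim) -!muln_modr !eqn_mul2l !modn_small ?ltn_ord //=.
by move/eqP/val_inj => s0s; rewrite s0s eqxx in s_s0.
Qed.

(** * Conjugate roots and minimal polynomials *)

Lemma root_in_alg_expr_card (F : finFieldType) (L : fieldExtType F) (p : {poly F}) (x : L) k :
  root (map_poly (in_alg L) p) x -> root (map_poly (in_alg L) p) (x ^+ (#|F| ^ k)).
Proof.
move=> rt; elim: k => [|k IH]; first by rewrite expr1.
rewrite expnSr exprM; move: (x ^+ _) IH => {rt} y /rootP y0; apply/rootP.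
(* The Frobenius power is additive on L and fixes the coefficients, so it commutes with
   evaluation. *)
suff -> : (map_poly (in_alg L) p).[y ^+ #|F|] = (map_poly (in_alg L) p).[y] ^+ #|F|.
  by rewrite y0 expr0n; case: #|F| (finNzRing_gt1 F) => [|[]].
have qnat : ([pchar L]).-nat #|F|.
  have [r r_pr rF] := finPcharP F.
  have rL : r \in [pchar L] by rewrite pchar_lalg.
  rewrite (eq_pnat _ (pcharf_eq rL)).
  have -> : #|F| = (r ^ logn r #|F|)%N := card_pprimeChar rF.
  by rewrite pnatX pnat_id.
elim/poly_ind: p {y0} => [|p c IH].
  by rewrite rmorph0 !horner0 expr0n; case: #|F| (finNzRing_gt1 F) => [|[]].
rewrite rmorphD rmorphM /= map_polyX map_polyC !hornerE /= IH (exprDn_pchar _ _ qnat) exprMn.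
by rewrite -[c%:A]/(in_alg L c) -rmorphXn /= expf_card.
Qed.

(** The degree of F(x) over F is at most that of L. An upper bound suffices: counting distinct roots
    later makes it sharp. *)
Lemma size_is_minpoly_le (F : fieldType) (L : fieldExtType F) (x : L) (p : {poly F}) :
  is_minpoly x p -> (size p <= (\dim {:L}).+1)%N.
Proof.
case=> _ _ p_min.
have /polyOver1P[r rE] : minPoly 1%AS x \is a polyOver 1%VS by exact: minPolyOver.
have : p %| r by apply: p_min; rewrite -rE root_minPoly.
move/dvdp_leq; rewrite -(size_map_poly (in_alg L) r) -rE size_minPoly => le_p.
apply: leq_trans (le_p _) _.
  by rewrite -(map_poly_eq0 (in_alg L)) -rE monic_neq0 ?monic_minPoly.
by rewrite ltnS adjoin_degreeE dimv1 divn1 dimvS ?subvf.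
Qed.

(** Distinct roots bound the degree from below, so the assumed upper bound is attained and no other
    root is left. *)
Lemma monic_prod_XsubC_roots (L : fieldType) (p : {poly L}) (rs : seq L) :
    p \is monic -> all (root p) rs -> uniq rs -> (size p <= (size rs).+1)%N ->
  p = \prod_(z <- rs) ('X - z%:P).
Proof.
move=> p_monic p_rs rs_uniq p_le.
have size_p : size p = (size rs).+1.
  by apply/eqP; rewrite eqn_leq p_le max_poly_roots ?monic_neq0.
by rewrite {1}(all_roots_prod_XsubC size_p p_rs) ?uniq_rootsE // (monicP p_monic) scale1r.
Qed.

Lemma size_prod_leq (R : nzRingType) (I : Type) (s : seq I) (M : I -> {poly R}) d :
  (forall i, (size (M i) <= d.+1)%N) ->
  (size (\prod_(i <- s) M i)%R <= (size s * d).+1)%N.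
Proof.
move=> M_le; elim: s => [|i s IH]; first by rewrite big_nil size_poly1.
rewrite big_cons; apply: leq_trans (size_polyMleq _ _) _.
by rewrite -subn1 leq_subLR; apply: leq_trans (leq_add (M_le i) IH) _; rewrite /=; lia.
Qed.

(** The square of beta^n is 1, while beta^n is not 1 because 0 < n < 2n. *)
Lemma prim_root_half_expr (L : fieldType) (n : nat) (beta : L) : (0 < n)%N ->
  (2 * n)%N.-primitive_root beta -> beta ^+ n = -1.
Proof.
move=> n_gt0 prim; have := prim_expr_order prim.
rewrite mulnC exprM => /eqP; rewrite sqrf_eq1 => /orP[|/eqP//].
rewrite -[1](expr0 beta) (eq_prim_root_expr prim) mod0n modn_small; last by lia.
by move=> /eqP n0; rewrite n0 in n_gt0.
Qed.

Lemma minpoly_dvdp (F : fieldType) (L : fieldExtType F) (x : L) (p h : {poly F}) :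
  is_minpoly x p -> (p %| h) = root (map_poly (in_alg L) h) x.
Proof.
case=> _ p_x p_min; apply/idP/idP => [/dvdpP[r ->]|/p_min //].
by rewrite rmorphM rootM p_x orbT.
Qed.

Theorem theorem24
  (F : finFieldType) (q : nat) (hq : #|F| = q) (hqodd : odd q)
  (m n : nat) (hm : (2 <= m)%N) (hn : n = ((q ^ m + 1) %/ 2)%N)
  (l : nat) (hl : is_mult_order q (2 * n) l)
  (L : fieldExtType F) (hL : \dim {:L} = l)
  (alpha : L) (halpha : (q ^ l - 1)%N.-primitive_root alpha)
  (beta : L) (hbeta : beta = alpha ^+ ((q ^ l - 1) %/ (2 * n)))
  (M : nat -> {poly F}) (hM : forall j, is_minpoly (beta ^+ j) (M j))
  (delta : nat) (hdelta2 : (2 <= delta)%N)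
  (hdelta : (~~ odd m /\ (4 <= m)%N /\ (delta <= (q ^ (m %/ 2) + 3) %/ 2)%N)
          \/ (odd m /\ (3 <= m)%N /\ (delta <= (q ^ ((m + 1) %/ 2) - q + 2) %/ 2)%N)) :
  let C := nbch_code n delta M in
  [/\ \dim C = (n - 2 * m * ceil_div ((2 * delta - 3) * (q - 1)) (2 * q))%N,
      is_generator_poly C
        (\prod_(0 <= i < delta.-1 | (i %% q != (q - 1) %/ 2)%N) M (1 + 2 * i)%N) &
      (if (delta %% q == ((q + 1) %/ 2) %% q)%N
       then (2 * delta + 1 <= min_dist C)%N
       else (2 * delta - 1 <= min_dist C)%N)].
Proof.
have q1 : (1 < q)%N by rewrite -hq finNzRing_gt1.
have q3 : (3 <= q)%N by case: q q1 hqodd {hq hn hl halpha hbeta hdelta} => [|[|[|]]].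
have nE : (2 * n = q ^ m + 1)%N.
  have : odd (q ^ m) by rewrite oddX hqodd orbT.
  by rewrite hn; move: (q ^ m)%N => Q; lia.
have n_gt0 : (0 < n)%N by lia.
have prim : (2 * n)%N.-primitive_root beta.
  rewrite hbeta; apply: (dvdn_prim_root halpha).
  case: hl => l0 /eqP ql _; rewrite -eqn_mod_dvd ?ql //.
  by rewrite expn_gt0 (ltnW q1).
(* From q^m = -1 modulo 2n follows q^(2m) = 1, so l > 2m would contradict the minimality of l. *)
have l_le : (l <= 2 * m)%N.
  rewrite leqNgt; apply/negP=> l_gt; case: hl => _ _ lt_l.
  have /lt_l/eqP[] : (0 < 2 * m < l)%N by rewrite l_gt; lia.
  rewrite nE mul2n -addnn expnD; apply/eqP; rewrite -(eqn_modDr (q ^ m)).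
  have -> : (q ^ m * q ^ m + q ^ m = q ^ m * (q ^ m + 1))%N by ring.
  by rewrite modnMl addnC modnn.
have size_M j : (size (M j) <= (2 * m).+1)%N.
  by apply: leq_trans (size_is_minpoly_le _ _ _ _ (hM j)) _; rewrite hL ltnS.
have M_neq0 j : M j != 0 by have [/monic_neq0] := hM j.
have Frob h x k : root (map_poly (in_alg L) h) x -> root (map_poly (in_alg L) h) (x ^+ (q ^ k)).
  by rewrite -hq; exact: root_in_alg_expr_card.
move=> C.
set P := (fun i => (i %% q != (q - 1) %/ 2)%N).
have PE i : P i = ~~ (q %| 1 + 2 * i)%N by rewrite dvdn_odd_index.
set g := \prod_(0 <= i < _ | _) _.
pose js := [seq i <- index_iota 0 delta.-1 | P i].
have gE : g = \prod_(i <- js) M (1 + 2 * i)%N by rewrite big_filter.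
have mem_js i : (i \in js) = ~~ (q %| 1 + 2 * i)%N && (i < delta.-1)%N.
  by rewrite mem_filter PE mem_index_iota.
(* The union of the cosets of the exponents prime to q: these will be all the roots of g, each
   listed once. *)
pose rs := [seq beta ^+ ((1 + 2 * i) * q ^ k) | i <- js, k <- iota 0 (2 * m)].
have g_monic : g \is monic by apply: monic_prod => i _; case: (hM (1 + 2 * i)%N).
have rs_uniq : uniq rs.
  apply: allpairs_uniq; rewrite ?filter_uniq ?iota_uniq //.
  move=> [i k] [i' k'] /allpairsP[[i1 k1] [/= + + [-> ->]]] /allpairsP[[i2 k2] [/= + + [-> ->]]].
  rewrite !mem_js !mem_iota !add0n => /andP[qi id] /andP[_ km] /andP[qi' id'] /andP[_ km'].
  move/eqP; rewrite /= (eq_prim_root_expr prim) nE => /eqP E.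
  have le_B a : ~~ (q %| 1 + 2 * a)%N -> (a < delta.-1)%N ->
      (0 < 1 + 2 * a <= 2 * delta - 3 - (q %| 2 * delta - 3))%N.
    move=> qa ad; have [aE|aE] := eqVneq (1 + 2 * a)%N (2 * delta - 3)%N.
      by rewrite -aE (negPf qa) subn0 leqnn.
    by case: (q %| _)%N; clear -aE ad; lia.
  have B_small t tm := designed_bound_small q m delta t q3 hdelta hdelta2 tm _ erefl.
  have [iE ->] := coset_leaders_distinct q m _ q1 B_small _ _ _ _
    (le_B _ qi id) (le_B _ qi' id') qi qi' km km' E.
  congr (_, _); clear -iE; lia.
have rs_root h :
    (forall i, (i < delta.-1)%N -> root (map_poly (in_alg L) h) (beta ^+ (1 + 2 * i))) ->
    all (root (map_poly (in_alg L) h)) rs.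
  move=> rt; apply/allP=> _ /allpairsP[[i k] [/= + _ ->]].
  by rewrite mem_js exprM => /andP[_ id]; apply/Frob/rt.
have g_root i : (i < delta.-1)%N -> root (map_poly (in_alg L) g) (beta ^+ (1 + 2 * i)).
  (* If 1 + 2i = cq, then c is odd and smaller, and beta^(cq) is a conjugate of beta^c. *)
  elim/ltn_ind: i => i IH id; have [qi|qi] := boolP (q %| 1 + 2 * i)%N; last first.
    rewrite -(minpoly_dvdp _ _ _ _ _ (hM _)) gE (big_rem i) ?mem_js ?qi //=.
    exact: dvdp_mulr.
  have /dvdnP[c cE] := qi; have c_odd : odd c.
    by have := congr1 odd cE; rewrite oddD oddM /= oddM hqodd andbT => <-.
  have -> : (1 + 2 * i = (1 + 2 * (c %/ 2)) * q ^ 1)%N.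
    by rewrite expn1 cE; congr muln; clear -c_odd; lia.
  by rewrite exprM; apply/Frob/IH; clear -cE c_odd q3 id; nia.
have size_rs : size rs = (size js * (2 * m))%N by rewrite size_allpairs size_iota.
(* Each factor of g has degree at most 2m, and [rs] supplies 2m distinct roots per factor. *)
have gL : map_poly (in_alg L) g = \prod_(z <- rs) ('X - z%:P).
  apply: monic_prod_XsubC_roots; rewrite ?map_monic ?rs_root //.
  by rewrite size_map_poly gE size_rs size_prod_leq.
have gP h : reflect
    (forall i, (i < delta.-1)%N -> root (map_poly (in_alg L) h) (beta ^+ (1 + 2 * i)))
    (g %| h).
  apply: (iffP idP) => [/dvdpP[r ->] i id|/rs_root h_rs].
    by rewrite rmorphM rootM g_root ?orbT.
  by rewrite -(dvdp_map (in_alg L)) gL uniq_roots_dvdp ?uniq_rootsE.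
(* An odd power of beta has n-th power -1. *)
have gX : g %| 'X ^+ n + 1.
  apply/gP=> i _; rewrite rmorphD rmorphXn rmorph1 /= map_polyX.
  rewrite rootE hornerD hornerXn hornerC exprAC (prim_root_half_expr _ _ _ n_gt0 prim).
  by rewrite -signr_odd oddD oddM /= expr1 addNr.
have CE : C = negacyclic_code n g.
  apply: negacyclic_code_eqp.
  (* The lcm and g have the same multiples, hence are associates. *)
  have lcmE h : (\big[@lcmp F/1]_(0 <= i < delta.-1) M (1 + 2 * i)%N %| h) = (g %| h).
    rewrite dvdp_biglcmp //; apply/allP/gP => rt i.
      by move=> id; rewrite -(minpoly_dvdp _ _ _ _ _ (hM _)) rt ?mem_index_iota.
    by rewrite mem_index_iota (minpoly_dvdp _ _ _ _ _ (hM _)); apply: rt.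
  by rewrite /eqp lcmE dvdpp -lcmE dvdpp.
split=> //.
  rewrite CE dim_negacyclic_code // -(size_map_poly (in_alg L)) gL size_prod_XsubC /= size_rs.
  by rewrite size_filter count_coset_leaders // mulnC.
have bch e : (2 * e + 1 <= n)%N ->
    (forall i, (i < e)%N -> root (map_poly (in_alg L) g) (beta ^+ (1 + 2 * i))) ->
    (2 * e + 1 <= min_dist C)%N.
  move=> en g_rt; apply: geq_min_dist => // c; rewrite CE mem_negacyclic_code // => /dvdpP[r cE] c0.
  have c_rt i : (i < e)%N -> root (map_poly (in_alg L) (rVpoly c)) (beta ^+ (1 + 2 * i)).
    by move=> /g_rt g_i; rewrite cE rmorphM rootM g_i orbT.
  (* Since beta ^+ (q ^ m) = beta^-1, the exponent (2e - 1) q^m stands for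
     -(2e - 1); the odd exponents from -(2e - 1) to 2e - 1 all give roots. *)
  rewrite addn1; apply: (BCH_bound F L n ((2 * e - 1) * q ^ m) (2 * e) beta c prim c0) => i ie.
  have [i_lt|i_ge] := ltnP i e.
    have -> : beta ^+ ((2 * e - 1) * q ^ m + 2 * i)
        = (beta ^+ (1 + 2 * (e - 1 - i))) ^+ (q ^ m).
      rewrite -exprM; apply/eqP; rewrite (eq_prim_root_expr prim) nE.
      have -> : ((2 * e - 1) * q ^ m + 2 * i
          = 2 * i * (q ^ m + 1) + (1 + 2 * (e - 1 - i)) * q ^ m)%N by clear -i_lt; nia.
      by rewrite modnMDl.
    by apply/Frob/c_rt; clear -i_lt; lia.
  have -> : beta ^+ ((2 * e - 1) * q ^ m + 2 * i) = beta ^+ (1 + 2 * (i - e)).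
    apply/eqP; rewrite (eq_prim_root_expr prim) nE.
    have -> : ((2 * e - 1) * q ^ m + 2 * i
        = (2 * e - 1) * (q ^ m + 1) + (1 + 2 * (i - e)))%N by clear -i_ge ie; nia.
    by rewrite modnMDl.
  by apply: c_rt; clear -i_ge ie; lia.
have d_le : (2 * delta + 1 <= n)%N by rewrite hn; apply: designed_distance_le.
case: ifP => [dq|_]; last first.
  have -> : (2 * delta - 1 = 2 * delta.-1 + 1)%N by clear -hdelta2; lia.
  by apply: bch => //; clear -d_le; lia.
(* Here q divides 2 delta - 1, so this exponent gives one more root, a conjugate of one already
   known, and e = delta replaces e = delta - 1. *)
apply: bch => // i; rewrite -[delta]prednK; last exact: ltnW.
rewrite ltnS leq_eqVlt => /orP[/eqP ->|]; last exact: g_root.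
have : (q %| 1 + 2 * delta.-1)%N.
  have : (2 * delta == 1 + q %[mod q])%N.
    have -> : (1 + q = 2 * ((q + 1) %/ 2))%N by clear -hqodd; lia.
    by rewrite -modnMmr (eqP dq) modnMmr.
  have -> : (2 * delta = 1 + (1 + 2 * delta.-1))%N by clear -hdelta2; lia.
  by rewrite eqn_modDl modnn.
case/dvdnP=> c cE; have c_odd : odd c.
  by have := congr1 odd cE; rewrite oddD oddM /= oddM hqodd andbT => <-.
have -> : (1 + 2 * delta.-1 = (1 + 2 * (c %/ 2)) * q ^ 1)%N.
  by rewrite expn1 cE; congr muln; clear -c_odd; lia.
rewrite exprM; apply/Frob/g_root.
by clear -cE c_odd q3 hdelta2; nia.
Qed.
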